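(* Let $N\ge1$, let $x_j=\cos\left(\frac{j\pi}{N}\right)$ for $j=0,\ldots,N$, let $s_i=[x_i,x_{i-1}]$ for $i=1,\ldots,N$, and let $\widetilde D_N\in\mathbb R^{N\times N}$ be defined by $[\widetilde D_N]_{ik}=\int_{s_i}T_k'(x)\,dx$, $i,k=1,\ldots,N$. Then the matrix $\widetilde D_N^\top\widetilde D_N$ is diagonal, with diagonal entries \[ [\widetilde D_N^\top\widetilde D_N]_{kk}=2N\sin^2\left(\frac{k\pi}{2N}\right),\quad k=1,\ldots,N-1,\qquad [\widetilde D_N^\top\widetilde D_N]_{NN}=4N . \] Consequently, the singular values of $\widetilde D_N$ are \[ \sigma_k(\widetilde D_N)=\sqrt{2N}\,\sin\left(\frac{k\pi}{2N}\right),\quad k=1,\ldots,N-1,\qquad \sigma_N(\widetilde D_N)=2\sqrt N . \]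
   Context: $T_k$ is the Chebyshev polynomial of the first kind of degree $k$, $T_k(\cos\theta)=\cos(k\theta)$. *)

(* Defs.v *)
From HB Require Import structures.
From mathcomp Require Import all_boot all_order all_algebra.
From mathcomp Require Import polyrcf.
From mathcomp Require Import all_classical all_reals all_analysis.
From mathcomp Require Import ring.

Set Implicit Arguments.
Unset Strict Implicit.
Unset Printing Implicit Defensive.

Import Order.TTheory GRing.Theory Num.Theory.
Local Open Scope ring_scope.

Fixpoint chebyshevT (R : nzRingType) (k : nat) : {poly R} :=
  match k with
  | 0 => 1
  | k'.+1 =>
    match k' with
    | 0 => 'X
    | k''.+1 => 'X * chebyshevT R k' *+ 2 - chebyshevT R k''
    end
  end.

Lemma chebyshevTSS (R : nzRingType) k :
  chebyshevT R k.+2 = 'X * chebyshevT R k.+1 *+ 2 - chebyshevT R k.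
Proof. by []. Qed.

Lemma chebyshevT_cos (R : realType) (k : nat) (t : R) :
  (chebyshevT R k).[cos t] = cos (k%:R * t).
Proof.
suff: (chebyshevT R k).[cos t] = cos (k%:R * t) /\
      (chebyshevT R k.+1).[cos t] = cos (k.+1%:R * t) by case.
elim: k => [|k [IH0 IH1]]; first by rewrite /= hornerX hornerC mul0r cos0 mul1r.
split=> //; rewrite chebyshevTSS hornerD hornerN hornerMn mulrC hornerMX IH0 IH1.
have -> : k.+2%:R * t = k.+1%:R * t + t by rewrite -[in LHS]natr1 mulrDl mul1r.
have -> : k%:R * t = k.+1%:R * t - t by rewrite -[in RHS]natr1 mulrDl mul1r addrK.
by rewrite cosB cosD; ring.
Qed.

Lemma size_chebyshevT (R : numDomainType) (k : nat) :
  size (chebyshevT R k) = k.+1.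
Proof.
suff: size (chebyshevT R k) = k.+1 /\ size (chebyshevT R k.+1) = k.+2 by case.
elim: k => [|k [IH0 IH1]]; first by rewrite /= size_polyC oner_eq0 size_polyX.
split=> //; rewrite chebyshevTSS -scaler_nat.
have s2 : size (2%:R *: ('X * chebyshevT R k.+1)) = k.+3.
  by rewrite size_scale ?pnatr_eq0// mulrC size_mulX ?IH1// -size_poly_eq0 IH1.
by rewrite size_polyDl s2// size_polyN IH0.
Qed.

Definition cheb_node (R : realType) (N j : nat) : R := cos (j%:R * pi / N%:R).

(* Cells are numbered from 1. *)
Definition cheb_cell (R : realType) (N i : nat) : set R :=
  `[cheb_node R N i, cheb_node R N i.-1]%classic.
Arguments cheb_cell : clear implicits.

(* Ordinals start at 0: the (i, k) entry here is the (i+1, k+1) entry in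
   1-based numbering. *)
Definition cheb_diff_mx (R : realType) (N : nat) : 'M[R]_N :=
  \matrix_(i < N, k < N)
    \int[lebesgue_measure]_(x in cheb_cell R N i.+1) ((chebyshevT R k.+1)^`()).[x].

(* Square roots of the eigenvalues of A^T A, repeated according to their
   multiplicity as roots of the characteristic polynomial, in increasing order
   (rootsR lists the roots of a polynomial increasingly, without repetition). *)
Definition singular_values (R : rcfType) (n : nat) (A : 'M[R]_n) : seq R :=
  let p := char_poly (A^T *m A) in
  flatten [seq nseq (mup a p) (Num.sqrt a) | a <- rootsR p].

(* Main.v *)
(* By the fundamental theorem of calculus and T_k(cos t) = cos(k t), the (i, k)
   entry (1-based) is cos(2(i-1)kh) - cos(2ikh) = 2 sin(kh) sin((2i-1)kh) with
   h = pi/(2N).  By product-to-sum, the Gram matrix only involves the sums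
   \sum_i cos((2i-1)mh) with m = k - l and m = k + l.  Multiplied by 2 sin(mh)
   such a sum telescopes to sin(m pi) = 0, so it vanishes unless mh is a
   multiple of pi, which only happens for m = 0 and for m = 2N (k = l = N). *)
Require Import Defs.
From HB Require Import structures.
From mathcomp Require Import all_boot all_order all_algebra.
From mathcomp Require Import polyrcf.
From mathcomp Require Import all_classical all_reals all_analysis.
From mathcomp Require Import ring lra zify.

Set Implicit Arguments.
Unset Strict Implicit.
Unset Printing Implicit Defensive.

Import Order.TTheory GRing.Theory Num.Theory.
Import numFieldNormedType.Exports.
Local Open Scope ring_scope.

Lemma Rintegral_deriv_horner (R : realType) (p : {poly R}) (a b : R) :
  a <= b ->
  \int[lebesgue_measure]_(x in `[a, b]%classic) p^`().[x] = p.[b] - p.[a].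
Proof.
rewrite le_eqVlt => /predU1P[<-|ab].
  by rewrite set_itv1 Rintegral_set1 subrr.
rewrite /Rintegral (@continuous_FTC2 _ _ (horner p))//.
- by apply: continuous_subspaceT => x; exact: continuous_horner.
- split.
  + by move=> x _; exact: derivable_horner.
  + by apply: cvg_at_right_filter; exact: continuous_horner.
  + by apply: cvg_at_left_filter; exact: continuous_horner.
- by move=> x _; rewrite derivE.
Qed.

Lemma sin_natmul_pi (R : realType) (m : nat) : sin (m%:R * pi) = 0 :> R.
Proof.
by elim: m => [|m IH]; rewrite ?mul0r ?sin0// -natr1 mulrDl mul1r sinDpi IH oppr0.
Qed.

Lemma cos_odd_pi (R : realType) (j : nat) : cos (j.*2.+1%:R * pi) = -1 :> R.
Proof.
elim: j => [|j IH]; first by rewrite mul1r cospi.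
have -> : j.+1.*2.+1%:R * pi = j.*2.+1%:R * pi + pi + pi :> R.
  by rewrite doubleS -2!natr1; ring.
by rewrite !cosDpi IH opprK.
Qed.

(** The induction step is $2\sin x\cos((2n+1)x)=\sin((2n+2)x)-\sin(2nx)$. The product form stays
    valid when $\sin x=0$. *)
Lemma sum_cos_odd (R : realType) (n : nat) (x : R) :
  (\sum_(j < n) cos (j.*2.+1%:R * x)) * (2 * sin x) = sin (n.*2%:R * x).
Proof.
elim: n => [|n IH]; first by rewrite big_ord0 !mul0r sin0.
rewrite big_ord_recr mulrDl IH /=.
have -> : n.+1.*2%:R * x = n.*2.+1%:R * x + x by rewrite doubleS -natr1; ring.
have -> : n.*2%:R * x = n.*2.+1%:R * x - x by rewrite -natr1; ring.
by rewrite sinB sinD; ring.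
Qed.

Section ChebyshevGram.
Variables (R : realType) (N : nat).
Hypothesis N_gt0 : (0 < N)%N.
Local Notation theta m := (m%:R * pi / (2 * N%:R) : R).
Local Notation D := (cheb_diff_mx R N).

Let N_neq0 : N%:R != 0 :> R. Proof. by rewrite pnatr_eq0 -lt0n. Qed.

(** The bounds on [m] place [theta m] strictly between 0 and $\pi$. This allows division by the sine
    in the cosine sums, and later gives the sign of the singular values. *)
Lemma sin_theta_gt0 m : (0 < m < N.*2)%N -> 0 < sin (theta m).
Proof.
move=> /andP[m0 mN]; have NR : 0 < 2 * N%:R :> R by rewrite mulr_gt0 ?ltr0n.
have pi0 := pi_gt0 R.
apply: sin_gt0_pi; rewrite divr_gt0 ?mulr_gt0 ?ltr0n//=.
by rewrite ltr_pdivrMr// mulrC ltr_pM2l// -natrM ltr_nat mul2n.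
Qed.

Lemma sum_cos_odd_theta m : (0 < m < N.*2)%N ->
  \sum_(j < N) cos (j.*2.+1%:R * theta m) = 0.
Proof.
move=> mN; have s0 := sin_theta_gt0 mN.
apply: (@mulIf _ (2 * sin (theta m))); first by rewrite mulf_neq0 ?gt_eqF.
rewrite sum_cos_odd mul0r -(sin_natmul_pi R m); congr sin.
by rewrite -mul2n natrM; field.
Qed.

Lemma cheb_diff_mxE (i k : 'I_N) :
  D i k = 2 * sin (theta k.+1) * sin (i.*2.+1%:R * theta k.+1).
Proof.
have pi0 := pi_gt0 R.
have cell (j : nat) : (j <= N)%N -> j%:R * pi / N%:R \in `[0, pi :> R].
  move=> jN; rewrite in_itv/=; apply/andP; split.
    by rewrite divr_ge0 ?mulr_ge0// ltW.
  by rewrite ler_pdivrMr ?ltr0n// mulrC ler_pM2l// ler_nat.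
(* Cosine decreases on $[0,\pi]$, so the node of larger index is the left endpoint of the cell. *)
rewrite mxE /cheb_cell Rintegral_deriv_horner; last first.
  apply: ltW; rewrite /cheb_node /= ltr_cos ?cell//; last exact: ltnW.
  by rewrite ltr_pM2r ?invr_gt0 ?ltr0n// ltr_pM2r// ltr_nat.
rewrite /cheb_node !chebyshevT_cos /=.
(* Both endpoint angles are written around their midpoint, so that the difference of cosines becomes
   a product of sines. *)
have -> : k.+1%:R * (i%:R * pi / N%:R) =
    i.*2.+1%:R * theta k.+1 - theta k.+1.
  by rewrite -[i.*2.+1%:R]natr1 -mul2n natrM; field.
have -> : k.+1%:R * (i.+1%:R * pi / N%:R) =
    i.*2.+1%:R * theta k.+1 + theta k.+1.
  by rewrite -[i.*2.+1%:R]natr1 -[i.+1%:R]natr1 -mul2n natrM; field.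
by rewrite cosB cosD; ring.
Qed.

(** Product-to-sum under the summation sign. The assumption [l <= k] makes the truncated [k - l] a
    true difference; the shift to 1-based indices cancels there but not in the sum. *)
Lemma cheb_gramE (k l : 'I_N) : (l <= k)%N ->
  (D^T *m D) k l = 2 * sin (theta k.+1) * sin (theta l.+1) *
    (\sum_(j < N) cos (j.*2.+1%:R * theta (k - l)%N)
     - \sum_(j < N) cos (j.*2.+1%:R * theta (k.+1 + l.+1)%N)).
Proof.
move=> lk; rewrite mxE -sumrB mulr_sumr; apply: eq_bigr => j _.
rewrite mxE !cheb_diff_mxE.
have -> : j.*2.+1%:R * theta (k - l)%N =
    j.*2.+1%:R * theta k.+1 - j.*2.+1%:R * theta l.+1.
  by rewrite -subSS natrB//; field.
have -> : j.*2.+1%:R * theta (k.+1 + l.+1)%N =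
    j.*2.+1%:R * theta k.+1 + j.*2.+1%:R * theta l.+1.
  by rewrite natrD; field.
by rewrite cosB cosD; ring.
Qed.

Lemma cheb_gram_is_diag : is_diag_mx (D^T *m D).
Proof.
have tri (k l : 'I_N) : (l < k)%N -> (D^T *m D) k l = 0.
  (* For [l < k < N], both [k - l] and [k.+1 + l.+1] lie strictly between 0 and [N.*2], so both sums
     vanish. *)
  move=> lk; rewrite cheb_gramE 1?ltnW// !sum_cos_odd_theta ?subrr ?mulr0//.
    by have := ltn_ord k; lia.
  by have := ltn_ord k; lia.
apply/is_diag_mxP => k l; rewrite neq_ltn => /orP[kl|]; last exact: tri.
(* Symmetry of the Gram matrix reduces the case [k < l] to the previous one. *)
have -> : D^T *m D = (D^T *m D)^T by rewrite trmx_mul trmxK.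
by rewrite mxE tri.
Qed.

Let sum_cos_theta0 : \sum_(j < N) cos (j.*2.+1%:R * theta 0) = N%:R.
Proof.
rewrite !mul0r; under eq_bigr do rewrite mulr0 cos0.
by rewrite sumr_const card_ord.
Qed.

Lemma cheb_gram_diag (k : 'I_N) : (k.+1 < N)%N ->
  (D^T *m D) k k = 2 * N%:R * sin (theta k.+1) ^+ 2.
Proof.
move=> kN; rewrite cheb_gramE// subnn sum_cos_theta0 sum_cos_odd_theta; last lia.
by ring.
Qed.

(** Here the second sum runs over cosines of odd multiples of $\pi$: it equals $-N$ instead of 0,
    which doubles the entry. *)
Lemma cheb_gram_diag_last (k : 'I_N) : k.+1 = N -> (D^T *m D) k k = 4 * N%:R.
Proof.
move=> kN; rewrite cheb_gramE// subnn sum_cos_theta0 kN.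
have -> : theta N = pi / 2 by field.
have -> : theta (N + N)%N = pi by rewrite natrD; field.
under [X in _ - X]eq_bigr do rewrite cos_odd_pi.
by rewrite sumr_const card_ord sin_pihalf -mulr_natr; ring.
Qed.

End ChebyshevGram.

Section SimpleSpectrum.
Variable R : rcfType.
Local Notation prodX s := (\prod_(a <- s) ('X - a%:P : {poly R})).

Lemma rootsR_prod_XsubC (s : seq R) : sorted <%R s -> rootsR (prodX s) = s.
Proof.
move=> ss; apply: lt_sorted_eq => //; first exact: sorted_roots.
move=> x; have p0 : prodX s != 0 by rewrite monic_neq0 ?monic_prod_XsubC.
by rewrite -(roots_on_rootsR p0) root_prod_XsubC.
Qed.

Lemma mup_prod_XsubC (s : seq R) (a : R) : mup a (prodX s) = count_mem a s.
Proof.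
elim: s => [|b s IH]; first by rewrite big_nil mupNroot// root1.
rewrite big_cons mupM ?polyXsubC_eq0 ?monic_neq0 ?monic_prod_XsubC// IH /=.
by rewrite -['X - _]expr1 mup_XsubCX; case: eqP.
Qed.

(** The diagonal entries are the roots of the characteristic polynomial. Being strictly increasing,
    they are simple and already in the order of [rootsR]. *)
Lemma singular_values_gram_diag (n : nat) (A : 'M[R]_n) (d : nat -> R) :
    is_diag_mx (A^T *m A) -> (forall i : 'I_n, (A^T *m A) i i = d i) ->
    sorted <%R [seq d i | i <- iota 0 n] ->
  singular_values A = [seq Num.sqrt (d i) | i <- iota 0 n].
Proof.
move=> Adiag dE ds; rewrite /singular_values.
have -> : char_poly (A^T *m A) = prodX [seq d i | i <- iota 0 n].
  rewrite char_poly_trig ?is_diag_mx_is_trig// big_map -[in RHS](subn0 n).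
  by rewrite big_mkord; apply: eq_bigr => i _; rewrite dE.
rewrite (rootsR_prod_XsubC ds) (map_comp Num.sqrt d).
set s := map d _ in ds *; have us : uniq s by exact: lt_sorted_uniq ds.
rewrite -[RHS]flatten_seq1 -map_comp; congr flatten.
by apply/eq_in_map => a sa /=; rewrite mup_prod_XsubC count_uniq_mem// sa.
Qed.

End SimpleSpectrum.

Theorem corollary3 (R : realType) (N : nat) (hN : (1 <= N)%N) :
  let D := cheb_diff_mx R N in
  [/\ is_diag_mx (D^T *m D),
      forall k : 'I_N, (k.+1 <= N.-1)%N ->
        (D^T *m D) k k = 2 * N%:R * sin (k.+1%:R * pi / (2 * N%:R)) ^+ 2,
      forall k : 'I_N, k.+1 = N -> (D^T *m D) k k = 4 * N%:R
    & singular_values D =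
        rcons [seq Num.sqrt (2 * N%:R) * sin (k%:R * pi / (2 * N%:R))
              | k <- iota 1 N.-1]
          (2 * Num.sqrt N%:R)].
Proof.
move=> D; split.
- exact: cheb_gram_is_diag.
- by move=> k kN; apply: cheb_gram_diag => //; lia.
- exact: cheb_gram_diag_last.
have NR : 0 < N%:R :> R by rewrite ltr0n.
have pi0 := pi_gt0 R.
pose s (k : nat) : R := sin (k.+1%:R * pi / (2 * N%:R)).
pose d k := if (k.+1 < N)%N then 2 * N%:R * s k ^+ 2 else 4 * N%:R.
have s_gt0 k : (k.+1 < N)%N -> 0 < s k.
  by move=> kN; apply: sin_theta_gt0 => //; lia.
(* All angles involved stay in $[0,\pi/2]$, where sine increases. *)
have s_ltS k l : (k < l)%N -> (l.+1 < N)%N -> s k < s l.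
  have mem (j : nat) : (j <= N)%N ->
      j%:R * pi / (2 * N%:R) \in `[- (pi / 2), (pi : R) / 2].
    move=> jN; rewrite in_itv/=; apply/andP; split.
      by apply: (@le_trans _ _ 0); rewrite ?oppr_le0 divr_ge0 ?mulr_ge0// ltW.
    rewrite ler_pdivrMr ?mulr_gt0// mulrA divfK// mulrC ler_pM2l//.
    by rewrite ler_nat.
  move=> kl lN; rewrite /s ltr_sin ?mem; [|lia..].
  by rewrite ltr_pM2r ?invr_gt0 ?mulr_gt0// ltr_pM2r// ltr_nat.
rewrite (@singular_values_gram_diag _ _ _ d) ?cheb_gram_is_diag//; first last.
- apply: (@homo_sorted_in _ _ (fun k => (k < N)%N) _ ltn); last first.
  + exact: iota_ltn_sorted.
  + by apply/allP => k; rewrite mem_iota.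
  move=> k l _ lN kl; rewrite /d (leq_ltn_trans kl lN); case: ifPn => [lN'|_].
    by rewrite ltr_pM2l ?mulr_gt0// ltr_pXn2r ?nnegrE ?ltW ?s_gt0 ?s_ltS//; lia.
  (* Comparison with the last entry: $2N s_k^2\le 2N<4N$. *)
  have : s k ^+ 2 <= 1 by rewrite sin2cos2 gerBl sqr_ge0.
  by move=> ?; rewrite -subr_gt0; nra.
- move=> k; rewrite /d; case: ifPn => kN; first exact: cheb_gram_diag.
  by apply: cheb_gram_diag_last => //; have := ltn_ord k; lia.
case: N hN @D NR @s @d s_gt0 {s_ltS} => // n _ D NR s d s_gt0.
(* The last index is split off; the others are then shifted by one to match [iota 1 N.-1]. *)
rewrite -[in iota 0 _]addn1 iotaD cats1 map_rcons /=; congr rcons.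
  rewrite (iotaDl 1 0) -map_comp; apply/eq_in_map => k; rewrite mem_iota => /= kn.
  have kN : (k.+1 < n.+1)%N by lia.
  by rewrite /d kN [LHS]sqrtrM ?mulr_ge0// sqrtr_sqr gtr0_norm ?s_gt0.
rewrite /d add0n ltnn sqrtrM// (_ : 4 = 2 ^+ 2) ?sqrtr_sqr ?ger0_norm//.
by rewrite expr2 -natrM.
Qed.
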